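(* Let $G=([n],E)$ be an undirected graph. Normals of antihole and odd wheel inequalities appear in $\mathcal{A}_G^{(2)}$. That is: (a) for every antihole $A$ in $G$ (with an odd or even number of vertices), $\mathbf{e}(A) \in \mathcal{A}_G^{(2)}$; (b) for every odd wheel $W$ in $G$ with central vertex $u_0$ and vertex set $V_W$, the vector $\sum_{i \in V_W \setminus \{u_0\}} \mathbf{e}_i + \frac{|V_W|-2}{2}\,\mathbf{e}_{u_0}$ lies in $\mathcal{A}_G^{(2)}$.
   Context: $\mathbf{e}_i$ is the $i$th standard unit vector of $\mathbb{R}^n$; for a subgraph $H$ with vertex set $V_H$, $\mathbf{e}(H) = \sum_{i \in V_H} \mathbf{e}_i$. A circuit is a closed walk with distinct vertices and edges. A hole is a chordless circuit, and an antihole is the complement of a hole (an antihole in $G$ being an induced subgraph of $G$ of this form); the antihole inequality is $\sum_{i \in V_A} x_i \leq 2$, with normal $\mathbf{e}(A)$. A wheel $W$ in $G$ is a circuit in $G$ together with an additional vertex $u_0$ (the central vertex) that is joined by edges to all vertices of the circuit; it is odd if $|V_W \setminus \{u_0\}|$ is odd. The odd wheel inequality is $\sum_{i \in V_W \setminus \{u_0\}} x_i + \frac{|V_W|-2}{2} x_{u_0} \leq \frac{|V_W|-2}{2}$. Let $\mathcal{A}_G := \{\mathbf{e}_i + \mathbf{e}_j : \{i,j\} \in E\} \cup \{-\mathbf{e}_i : i \in [n]\}$. A basis in a set of vectors of $\mathbb{Z}^n$ is a subset of $n$ linearly independent vectors, and the cone generated by it is a basis cone. The minimal Hilbert basis of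 a pointed rational cone is the unique minimal finite set of its integer points such that every integer point of the cone is a nonnegative integer combination of elements of the set. Set $\mathcal{A}_G^{(0)} = \mathcal{A}_G$, and for $k \geq 1$ let $\mathcal{A}_G^{(k)}$ be the union of the minimal Hilbert bases of all basis cones of $\mathcal{A}_G^{(k-1)}$.
   Formalization: In (a) the formal theorem requires the antihole A to have at least 5 vertices; with holes of length 3 or 4 allowed the claim fails (G = three isolated vertices, or G = two disjoint edges, where the iterated system never changes and does not contain e(A)). *)

(* Defs.v *)
From HB Require Import structures.
From mathcomp Require Import all_boot all_order all_algebra finmap.
Set Implicit Arguments.
Unset Strict Implicit.
Unset Printing Implicit Defensive.
Import Order.TTheory GRing.Theory Num.Theory.
Local Open Scope ring_scope.

Section Graphs.
Variables (T : finType) (e : rel T).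

(* Closed walk c_0, ..., c_(k-1), c_0 with distinct vertices; the edges are
   then distinct exactly when k is not 2, and k = 1 would need a loop. *)
Definition circuit (c : seq T) : Prop := (2 < size c)%N /\ ucycle e c.

Definition chordless (c : seq T) : Prop :=
  {in c &, forall x y, e x y -> (y == next c x) || (x == next c y)}.

Definition hole (c : seq T) : Prop := circuit c /\ chordless c.

Definition induced (A : {set T}) : rel T :=
  [rel x y | [&& x \in A, y \in A & e x y]].

(* Complement of a graph whose vertex set is A. *)
Definition complement_on (A : {set T}) : rel T :=
  [rel x y | [&& x \in A, y \in A, x != y & ~~ e x y]].

(* W is the vertex set of the wheel and u its central vertex; the rim may have
   chords. *)
Definition wheel (W : {set T}) (u : T) : Prop :=
  exists c : seq T,
    [/\ circuit c, u \notin c, {in c, forall x, e u x} & W =i u :: c].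

Definition odd_wheel (W : {set T}) (u : T) : Prop :=
  wheel W u /\ odd #|W :\ u|.

End Graphs.

(* A is the vertex set of an antihole: the induced subgraph on A is the
   complement of a hole. With holes of length 3 or 4 allowed, as here, the
   antihole is three isolated vertices (and the sum of x_i over A is not
   bounded by 2 on stable sets) or two disjoint edges (and e(A) need not be in
   any A_G^(k): if G itself is two disjoint edges, all bases of A_G are
   unimodular, so A_G^(k) = A_G). Antiholes are therefore meant to have at least
   five vertices. *)
Definition antihole (T : finType) (e : rel T) (A : {set T}) : Prop :=
  exists c : seq T, A =i c /\ hole (complement_on (induced e A) A) c.

Section HilbertBases.
Variables (R : realFieldType) (n : nat).

(* The cone in R^n generated by the rows of B. *)
Definition cone (B : 'M[int]_n) (x : 'rV[R]_n) : Prop :=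
  exists2 a : 'rV[R]_n, (forall i, 0 <= a 0 i) & x = a *m map_mx intr B.

Definition integer_point (C : 'rV[R]_n -> Prop) (z : 'rV[int]_n) : Prop :=
  C (map_mx intr z).

Definition hilbert_basis (C : 'rV[R]_n -> Prop) (H : {fset 'rV[int]_n}) : Prop :=
  (forall h, h \in H -> integer_point C h) /\
  (forall z, integer_point C z ->
     exists k : 'rV[int]_n -> nat, z = \sum_(h <- H) h *+ k h).

Definition minimal_hilbert_basis (C : 'rV[R]_n -> Prop)
    (H : {fset 'rV[int]_n}) : Prop :=
  hilbert_basis C H /\
  (forall H' : {fset 'rV[int]_n}, (H' `<=` H)%fset -> hilbert_basis C H' -> H' = H).

(* The rows of B are n linearly independent vectors of S. *)
Definition basis_in (S : 'rV[int]_n -> Prop) (B : 'M[int]_n) : Prop :=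
  (forall i, S (row i B)) /\ row_free (map_mx intr B : 'M[R]_n).

Definition hilbert_step (S : 'rV[int]_n -> Prop) (v : 'rV[int]_n) : Prop :=
  exists B : 'M[int]_n, basis_in S B /\
  exists H : {fset 'rV[int]_n}, minimal_hilbert_basis (cone B) H /\ v \in H.

End HilbertBases.

Section GraphVectors.
Variables (n : nat) (e : rel 'I_n).

Definition unit_vec (i : 'I_n) : 'rV[int]_n := delta_mx 0 i.

Definition edge_system (v : 'rV[int]_n) : Prop :=
  (exists i j, e i j /\ v = unit_vec i + unit_vec j) \/
  (exists i, v = - unit_vec i).

(* A_G^(k) *)
Definition iterated_system (R : realFieldType) (k : nat) : 'rV[int]_n -> Prop :=
  iter k (@hilbert_step R n) edge_system.

Definition incidence_vec (A : {set 'I_n}) : 'rV[int]_n :=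
  \sum_(i in A) unit_vec i.

(* #|W| is even and at least 4 for an odd wheel, so the natural-number
   subtraction and halving are exact. *)
Definition wheel_vec (W : {set 'I_n}) (u : 'I_n) : 'rV[int]_n :=
  \sum_(i in W :\ u) unit_vec i + unit_vec u *+ (#|W| - 2)./2.

End GraphVectors.

(* Main.v *)
Require Import Defs.
From Stdlib Require Import Classical.
From mathcomp Require Import all_boot all_order all_algebra finmap.
From mathcomp Require Import zify lra.
Import Order.TTheory GRing.Theory Num.Theory.
Local Open Scope ring_scope.

Set Implicit Arguments.
Unset Strict Implicit.
Unset Printing Implicit Defensive.

(** Two families of vectors already lie in the first iterate. Each - e_j does,
    since a primitive vector of the system spanning a ray of a unimodular basis
    cone survives. So does e(C) for every circuit C with an odd number of
    vertices: the edge vectors of C together with - e_j for j outside C form a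
    basis of determinant +-2, and e(C), half the sum of the edge vectors, is
    irreducible in its cone (step1_odd_cycle).

    An antihole A with an odd number k of vertices is spanned by an odd circuit
    of G, namely i |-> i + 2 modulo k along the cycle of the complement, so
    e(A) is in the first iterate, hence in the second. If k is even, deleting
    a vertex x from A leaves the complement of a path on the odd number k - 1
    of vertices, which the same doubling map turns into an odd circuit of G
    (doubling_cycle). So all e(A) - e_x are in the first iterate; together with
    the - e_j for j outside A they form a basis, and e(A), which is their sum
    divided by k - 1, is irreducible in the cone (hilbert_step_codim1).

    For an odd wheel, the triangles formed by the centre u and the rim edges
    are odd circuits. Their vectors and the - e_j for j off the rim form
    a basis; half the sum of all the triangle vectors and of - e_u is the wheel
    vector. This is the same cone as for an odd circuit, each edge being joined
    to a fixed set D of further vertices, so one lemma, hilbert_step_odd_cycle,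
    covers circuits (D empty) and wheels (D = {u}).

    All these bases complete a family (f_i), i in A, by the vectors - e_j with
    j outside A. For such a basis hilbert_step_completion reduces membership of
    a vector in the next iterate to computations with the coordinates in A. It
    rests on the existence of Hilbert bases of simplicial cones and on the fact
    that a Hilbert basis contains every irreducible integer point. *)

(** * Hilbert bases of simplicial cones *)

Definition nat_comb (n : nat) (H : {fset 'rV[int]_n}) (z : 'rV[int]_n) : Prop :=
  exists k : 'rV[int]_n -> nat, z = \sum_(h <- H) h *+ k h.

Lemma nat_comb0 n (H : {fset 'rV[int]_n}) : nat_comb H 0.
Proof. by exists (fun=> 0%N); rewrite big1. Qed.

Lemma nat_combD n (H : {fset 'rV[int]_n}) y z :
  nat_comb H y -> nat_comb H z -> nat_comb H (y + z).
Proof.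
move=> [k ->] [l ->]; exists (fun h => (k h + l h)%N).
by rewrite -big_split; apply: eq_bigr => h _; rewrite mulrnDr.
Qed.

Lemma nat_comb_mem n (H : {fset 'rV[int]_n}) h : h \in H -> nat_comb H h.
Proof.
move=> hH; exists (fun x => (x == h) : nat).
rewrite (big_fsetD1 h hH) /= eqxx mulr1n big_seq big1 ?addr0 // => x.
by rewrite in_fsetD1 => /andP[/negPf->].
Qed.

Lemma nat_combMn n (H : {fset 'rV[int]_n}) z m :
  nat_comb H z -> nat_comb H (z *+ m).
Proof.
move=> Hz; elim: m => [|m IHm]; first by rewrite mulr0n; exact: nat_comb0.
by rewrite mulrS; exact: nat_combD.
Qed.

Lemma coneD (R : realFieldType) n (B : 'M[int]_n) (x y : 'rV[R]_n) :
  cone B x -> cone B y -> cone B (x + y).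
Proof.
move=> [a a_ge0 ->] [b b_ge0 ->]; exists (a + b); last by rewrite mulmxDl.
by move=> i; rewrite mxE addr_ge0.
Qed.

Lemma cone0 (R : realFieldType) n (B : 'M[int]_n) : cone B (0 : 'rV[R]_n).
Proof. by exists 0; rewrite ?mul0mx // => i; rewrite mxE. Qed.

Lemma nat_comb_cone (R : realFieldType) n (B : 'M[int]_n) (H : {fset 'rV[int]_n}) z :
  (forall h, h \in H -> integer_point (@cone R n B) h) ->
  nat_comb H z -> integer_point (@cone R n B) z.
Proof.
move=> HB [k ->]; rewrite big_seq; elim/big_ind: _ => [|x y|h hH].
- by rewrite /integer_point map_mx0; exact: cone0.
- by rewrite /integer_point map_mxD; exact: coneD.
elim: (k h) => [|m IHm].
  by rewrite mulr0n /integer_point map_mx0; exact: cone0.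
by rewrite mulrS /integer_point map_mxD; apply: coneD => //; exact: HB.
Qed.

Lemma map_intr_inj (R : realFieldType) n (y z : 'rV[int]_n) :
  map_mx intr y = map_mx intr z :> 'rV[R]_n -> y = z.
Proof.
move=> eq_yz; apply/rowP => j; have /rowP/(_ j) := eq_yz; rewrite !mxE.
by move/eqP; rewrite eqr_int => /eqP.
Qed.

Lemma det_row_free (R : realFieldType) n (B : 'M[int]_n) :
  row_free (map_mx intr B : 'M[R]_n) -> \det B != 0.
Proof.
by rewrite row_free_unit unitmxE det_map_mx unitfE intr_eq0.
Qed.

(** Cramer's rule makes the coefficients of an integer point over the rows of B
    natural numbers divided by |det B|. The field R, which need not be
    archimedean, thereby disappears, and integer parts of coefficients become
    available as Euclidean quotients. *)
Lemma integer_point_coneP (R : realFieldType) n (B : 'M[int]_n) (z : 'rV[int]_n) :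
  row_free (map_mx intr B : 'M[R]_n) ->
  integer_point (@cone R n B) z <->
  exists p : 'I_n -> nat, z *+ `|\det B|%N = \sum_i row i B *+ p i.
Proof.
move=> /det_row_free detB; split.
  case=> a a_ge0 def_z; exists (fun i => `|(z *m \adj B) ord0 i|%N).
  apply: (@map_intr_inj R); rewrite raddfMn /= def_z raddf_sum /=.
  rewrite mulmx_sum_row -sumrMnl; apply: eq_bigr => i _.
  rewrite raddfMn /= map_row -!scaler_nat scalerA; congr (_ *: _).
  have adj_a : ((z *m \adj B) 0 i)%:~R = a 0 i * (\det B)%:~R :> R.
    have -> : (((z *m \adj B) 0 i)%:~R : R) = map_mx intr (z *m \adj B) 0 i.
      by rewrite [RHS]mxE.
    rewrite map_mxM def_z -mulmxA -map_mxM mul_mx_adj map_scalar_mx.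
    by rewrite mul_mx_scalar mxE mulrC.
  rewrite !natr_absz !intr_norm adj_a normrM (ger0_norm (a_ge0 i)).
  by rewrite mulrC.
case=> p def_z; have D_gt0 : (0 < `|\det B|)%N by rewrite absz_gt0.
exists (\row_i ((p i)%:R / (`|\det B|%N)%:R)).
  by move=> i; rewrite mxE divr_ge0.
have D_neq0 : (`|\det B|%N)%:R != 0 :> R by rewrite pnatr_eq0 -lt0n.
apply: (scalerI D_neq0); rewrite scaler_nat -raddfMn /= def_z raddf_sum /=.
rewrite mulmx_sum_row scaler_sumr; apply: eq_bigr => i _.
by rewrite raddfMn /= map_row mxE scalerA mulrC divfK // scaler_nat.
Qed.

(** The combination of the rows of B with coefficients p i / D, truncated
    coordinatewise, so that it is total in p. *)
Definition box_point n (B : 'M[int]_n) (D : nat) (p : 'I_n -> nat) : 'rV[int]_n :=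
  map_mx (fun x => x %/ D)%Z (\sum_i row i B *+ p i).

Lemma box_pointE n (B : 'M[int]_n) D p (z : 'rV[int]_n) :
  (0 < D)%N -> z *+ D = \sum_i row i B *+ p i -> box_point B D p = z.
Proof.
move=> D_gt0 def_z; apply/rowP => j; rewrite mxE -def_z mulmxnE.
by rewrite -mulr_natr natz mulzK // eqz_nat -lt0n.
Qed.

(** Gordan's lemma for a simplicial cone: writing each coefficient over the rows
    of B as its integer part plus its fractional part shows that the integer
    points with all coefficients in [0, 1], of which there are finitely many,
    generate all others. *)
Lemma exists_hilbert_basis (R : realFieldType) n (B : 'M[int]_n) :
  row_free (map_mx intr B : 'M[R]_n) -> exists H, hilbert_basis (@cone R n B) H.
Proof.
move=> freeB; have D_gt0 : (0 < `|\det B|)%N.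
  by rewrite absz_gt0 (det_row_free freeB).
set D := `|\det B|%N in D_gt0 *.
pose good (p : {ffun 'I_n -> 'I_D.+1}) :=
  box_point B D (fun i => p i) *+ D == \sum_i row i B *+ p i.
pose H : {fset 'rV[int]_n} :=
  [fset x in [seq box_point B D (fun i => p i) | p : {ffun 'I_n -> 'I_D.+1} in good]]%fset.
(* The bound is D rather than D - 1 so that the rows of B themselves are in H. *)
have memH (p : 'I_n -> nat) z : (forall i, (p i <= D)%N) ->
    z *+ D = \sum_i row i B *+ p i -> z \in H.
  move=> p_le def_z; pose q := [ffun i => inord (p i) : 'I_D.+1].
  have qE i : q i = p i :> nat by rewrite ffunE inordK // ltnS.
  have def_zq : z *+ D = \sum_i row i B *+ q i.
    by rewrite def_z; apply: eq_bigr => i _; rewrite qE.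
  rewrite inE; apply/imageP; exists q; last by rewrite (box_pointE D_gt0 def_zq).
  by rewrite unfold_in (box_pointE D_gt0 def_zq) def_zq.
exists H; split.
  move=> h; rewrite inE => /imageP[p]; rewrite unfold_in => /eqP good_p ->.
  by apply/integer_point_coneP => //; exists (fun i => p i : 'I_D.+1).
move=> z /(integer_point_coneP _ freeB)[p def_z]; change (nat_comb H z).
have rowsH i : row i B \in H.
  apply: (memH (fun j => ((j == i) * D)%N)) => [j|]; first by case: eqP; lia.
  rewrite (bigD1 i) //= eqxx mul1n big1 ?addr0 // => j /negPf->.
  by rewrite mul0n mulr0n.
have [q qE] : exists q, q = \sum_i row i B *+ (p i %/ D) by eexists.
have -> : z = q + (z - q) by rewrite addrC subrK.
apply: nat_combD.
  rewrite qE; elim/big_ind: _ => [|x y|i _]; first exact: nat_comb0.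
    exact: nat_combD.
  exact/nat_combMn/nat_comb_mem.
apply/nat_comb_mem/(memH (fun i => (p i %% D)%N)) => [i|].
  by rewrite ltnW // ltn_mod.
rewrite mulrnBl def_z qE -sumrMnl -sumrB; apply: eq_bigr => i _.
by rewrite -mulrnA {1}(divn_eq (p i) D) mulrnDr addrC addKr.
Qed.

Lemma exists_minimal_hilbert_basis (R : realFieldType) n
    (C : 'rV[R]_n -> Prop) (H : {fset 'rV[int]_n}) :
  hilbert_basis C H -> exists H', minimal_hilbert_basis C H'.
Proof.
have [m] := ubnP #|`H|; elim: m => // m IHm in H *; rewrite ltnS => le_H_m basisH.
have [minH | /not_all_ex_not[H' not_minH]] := classic (forall H' : {fset 'rV[int]_n},
    (H' `<=` H)%fset -> hilbert_basis C H' -> H' = H).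
  by exists H.
have [sH'H not_minH'] := imply_to_and _ _ not_minH.
have [basisH' /eqP neq_H'H] := imply_to_and _ _ not_minH'.
apply: (IHm H') => //; apply: leq_trans le_H_m; apply: fproper_ltn_card.
by rewrite fproperEneq neq_H'H.
Qed.

(** If h occurs in the expression of v as a combination of the Hilbert basis,
    then v = h + (v - h) with both terms in the cone, so v = h. *)
Lemma hilbert_basis_irreducible (R : realFieldType) n (B : 'M[int]_n)
    (H : {fset 'rV[int]_n}) v :
  hilbert_basis (@cone R n B) H -> v != 0 -> integer_point (@cone R n B) v ->
  (forall y z, integer_point (@cone R n B) y -> integer_point (@cone R n B) z ->
     v = y + z -> y = 0 \/ z = 0) ->
  v \in H.
Proof.
move=> [coneH genH] v_neq0 /genH[k def_v] irr_v.
have /hasP[h hH] : has (fun h => h *+ k h != 0) H.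
  apply: contraNT v_neq0 => /hasPn no_h; rewrite def_v big_seq big1 // => h hH.
  by apply/eqP/negPn/no_h.
move=> khh; have h_neq0 : h != 0 by apply: contraNneq khh => ->; rewrite mul0rn.
have kh_gt0 : (0 < k h)%N.
  by rewrite lt0n; apply: contraNneq khh => ->; rewrite mulr0n.
have coneB z : nat_comb H z -> integer_point (@cone R n B) z.
  exact: nat_comb_cone.
have [] := irr_v h (v - h).
- exact: coneH.
- apply: coneB; exists (fun x => (k x - (x == h))%N).
  rewrite def_v (big_fsetD1 h hH) [RHS](big_fsetD1 h hH) /= eqxx.
  rewrite mulrnBr // mulr1n addrAC; congr (_ + _).
  rewrite big_seq [RHS]big_seq; apply: eq_bigr => x.
  by rewrite in_fsetD1 => /andP[/negPf-> _]; rewrite subn0.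
- by rewrite addrC subrK.
- by move=> h0; rewrite h0 eqxx in h_neq0.
by move/eqP; rewrite subr_eq0 => /eqP->.
Qed.

(** * Bases completed by opposite unit vectors *)

Definition comb_coord (R : realFieldType) n (A : {set 'I_n})
    (f : 'I_n -> 'rV[int]_n) (a : 'I_n -> R) (j : 'I_n) : R :=
  \sum_(i in A) a i * (f i ord0 j)%:~R.

(** Columns outside A meet the rows outside A only on the diagonal, so the
    completion is a basis as soon as the f i are independent on the
    coordinates in A. *)
Definition completion n (A : {set 'I_n}) (f : 'I_n -> 'rV[int]_n) : 'M[int]_n :=
  \matrix_i (if i \in A then f i else - unit_vec i).

Lemma mul_completion (R : realFieldType) n (A : {set 'I_n}) f (a : 'rV[R]_n) j :
  (a *m map_mx intr (completion A f)) ord0 j =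
    comb_coord A f (a ord0) j - (if j \in A then 0 else a ord0 j).
Proof.
rewrite mxE (bigID (mem A)) /=; congr (_ + _).
  by apply: eq_bigr => i iA; rewrite !mxE iA.
have off i : i \notin A ->
    a 0 i * map_mx intr (completion A f) i j = - (a 0 i * (j == i)%:R).
  move=> /negPf iA; rewrite !mxE iA !mxE eqxx /= rmorphN mulrN.
  by case: (j == i).
rewrite (eq_bigr _ off) sumrN; congr (- _); case: ifP => jA.
  apply: big1 => i iA; case: eqP => [eq_ji|_]; last by rewrite mulr0.
  by rewrite -eq_ji jA in iA.
rewrite (bigD1 j) ?jA //= eqxx mulr1 big1 ?addr0 // => i /andP[_ /negPf].
by rewrite eq_sym => ->; rewrite mulr0.
Qed.

Lemma comb_coord_eq0 (R : realFieldType) n (A : {set 'I_n}) f (a : 'I_n -> R) j :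
  {in A, forall i, a i = 0} -> comb_coord A f a j = 0.
Proof. by move=> a0; apply: big1 => i /a0->; rewrite mul0r. Qed.

(** Criterion for v, with coefficients alpha over the completed basis, to be in
    the next iterate. A summand y of v in the cone has coefficients between 0
    and alpha. The main hypothesis says that integrality on the coordinates in
    A forces its coefficients in A to be those of 0 or those of v. If they are
    those of 0, an outer coordinate of y is an integer in ]-1, 0], because
    alpha is less than 1 there, hence zero; if they are those of v, this
    applies to v - y. So v is irreducible. *)
Lemma hilbert_step_completion (R : realFieldType) n (S : 'rV[int]_n -> Prop)
    (A : {set 'I_n}) (f : 'I_n -> 'rV[int]_n) (alpha : 'I_n -> R)
    (v : 'rV[int]_n) :
  {in A, forall i, S (f i)} ->
  (forall i, i \notin A -> S (- unit_vec i)) ->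
  (forall a : 'I_n -> R, {in A, forall j, comb_coord A f a j = 0} ->
     {in A, forall i, a i = 0}) ->
  (forall i, 0 <= alpha i) ->
  (forall i, i \notin A -> alpha i < 1) ->
  (forall j, (v ord0 j)%:~R =
     comb_coord A f alpha j - (if j \in A then 0 else alpha j)) ->
  (forall (a : 'I_n -> R) (y : 'I_n -> int),
     {in A, forall i, 0 <= a i <= alpha i} ->
     {in A, forall j, comb_coord A f a j = (y j)%:~R} ->
     {in A, forall i, a i = 0} \/ {in A, forall i, a i = alpha i}) ->
  v != 0 ->
  hilbert_step R S v.
Proof.
move=> Sf SN freeA alpha_ge0 alpha_lt1 def_v irrA v_neq0.
set B := completion A f.
have freeB : row_free (map_mx intr B : 'M[R]_n).
  apply: inj_row_free => a /rowP aB0.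
  have a0 : {in A, forall i, a ord0 i = 0}.
    apply: freeA => j jA; have := aB0 j.
    by rewrite mul_completion jA subr0 mxE.
  apply/rowP => j; rewrite mxE; have [/a0//|jA] := boolP (j \in A).
  have := aB0 j; rewrite mul_completion (negPf jA) mxE comb_coord_eq0 //.
  by rewrite sub0r => /eqP; rewrite oppr_eq0 => /eqP.
have defv : map_mx intr v = (\row_i alpha i) *m map_mx intr B.
  apply/rowP => j; rewrite mul_completion !mxE def_v; congr (_ - _).
  by apply: eq_bigr => i _; rewrite mxE.
have [H0 basisH0] := exists_hilbert_basis freeB.
have [H minH] := exists_minimal_hilbert_basis basisH0.
exists B; split.
  by split=> // i; rewrite rowK; case: ifPn => [/Sf|/SN].
exists H; split=> //.
apply: (hilbert_basis_irreducible minH.1 v_neq0).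
  by exists (\row_i alpha i) => // i; rewrite mxE.
have zero (a : 'rV[R]_n) y : map_mx intr y = a *m map_mx intr B ->
    (forall i, 0 <= a ord0 i <= alpha i) -> {in A, forall i, a ord0 i = 0} ->
    y = 0.
  move=> def_y le_a a0; apply/rowP => j; rewrite mxE.
  have := congr1 (fun u : 'rV[R]_n => u ord0 j) def_y.
  rewrite mxE mul_completion comb_coord_eq0 //; case: ifPn => jA.
    by rewrite subr0 => /eqP; rewrite intr_eq0 => /eqP.
  move=> yE; have /andP[ge0 leal] := le_a j; have lt1 := alpha_lt1 j jA.
  have : (y 0 j)%:~R <= 0%:~R :> R by rewrite yE; lra.
  have : (-1)%:~R < (y 0 j)%:~R :> R by rewrite yE; lra.
  rewrite ltr_int ler_int; lia.
move=> y z [a a_ge0 def_y] [b b_ge0 def_z] def_yz.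
have def_ab : a + b = \row_i alpha i.
  apply: (row_free_inj freeB); rewrite mulmxDl -def_y -def_z -defv def_yz.
  by rewrite map_mxD.
have abE i : a ord0 i + b ord0 i = alpha i.
  by have /rowP/(_ i) := def_ab; rewrite !mxE.
have le_a i : 0 <= a ord0 i <= alpha i by rewrite a_ge0 -abE lerDl b_ge0.
have le_b i : 0 <= b ord0 i <= alpha i by rewrite b_ge0 -abE lerDr a_ge0.
have := irrA (a ord0) (y ord0) (fun i _ => le_a i).
case=> [j jA|a0|a1].
- have := congr1 (fun u : 'rV[R]_n => u ord0 j) def_y.
  by rewrite mxE mul_completion jA subr0.
- by left; exact: zero def_y le_a a0.
right; apply: zero def_z le_b _ => i iA.
by have := abE i; rewrite a1 // => /eqP; rewrite -subr_eq0 addrAC subrr add0r => /eqP.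
Qed.

Lemma intr_01 (R : realFieldType) (x : int) :
  -1 < x%:~R :> R -> x%:~R < 2 :> R -> x = 0 \/ x = 1.
Proof.
have -> : -1 = (-1)%:~R :> R by rewrite rmorphN1.
have -> : 2 = 2%:~R :> R by [].
rewrite !ltr_int; lia.
Qed.

(** A vector of the system with a coordinate +-1 stays in the next iterate: with
    the other opposite unit vectors it forms a unimodular basis. *)
Lemma hilbert_step_mem (R : realFieldType) n (S : 'rV[int]_n -> Prop) v i :
  S v -> `|v ord0 i| = 1 -> (forall j, S (- unit_vec j)) -> hilbert_step R S v.
Proof.
move=> Sv vi1 SN.
have vi_cases : v ord0 i = 1 \/ v ord0 i = -1 by lia.
have coordE (a : 'I_n -> R) j : comb_coord [set i] (fun=> v) a j = a i * (v 0 j)%:~R.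
  by rewrite /comb_coord big_set1.
apply: (@hilbert_step_completion R n S [set i] (fun=> v) (fun j => (j == i)%:R)) => //.
- move=> a a0 j /set1P->; have := a0 i (set11 i); rewrite coordE.
  by case: vi_cases => ->; lra.
- by move=> j; rewrite inE => /negPf->.
- move=> j; rewrite coordE eqxx mul1r inE; case: eqP => _; by rewrite subr0.
- move=> a y le_a yE; have /andP[ge0 le1] : 0 <= a i <= 1.
    by have := le_a i (set11 i); rewrite eqxx.
  have := yE i (set11 i); rewrite coordE => yi.
  suff : a i = 0 \/ a i = 1.
    by case=> ai; [left|right] => j /set1P->; rewrite ?eqxx.
  have [z aiE] : exists z : int, a i = z%:~R.
    case: vi_cases yi => ->; first by rewrite mulr1 => ->; exists (y i).
    by exists (- y i); rewrite rmorphN /= -yi mulrN mulr1 opprK.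
  have : z = 0 \/ z = 1.
    by apply: (@intr_01 R); rewrite -aiE; lra.
  by rewrite aiE => -[]->; [left|right].
- by apply: contra_eqN vi1 => /eqP->; rewrite mxE.
Qed.
Lemma iter_next_mem (T : finType) (c : seq T) x i :
  x \in c -> iter i (next c) x \in c.
Proof. by move=> xc; elim: i => //= i IHi; rewrite mem_next. Qed.

Lemma next_closed_all (T : finType) (c : seq T) (P : T -> Prop) :
  uniq c -> {in c, forall x, P x -> P (next c x)} ->
  {in c &, forall x y, P x -> P y}.
Proof.
move=> Uc closedP x y xc yc Px.
have : fconnect (next c) x y by rewrite (fconnect_cycle (cycle_next Uc)).
move=> /iter_findex <-; elim: (findex _ _ _) => //= i IHi.
by apply: closedP => //; exact: iter_next_mem.
Qed.

(** Going once around the cycle multiplies a by (-1)^(size c) = -1. *)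
Lemma odd_cycle_antiperiodic (R : realFieldType) (T : finType) (c : seq T)
    (a : T -> R) :
  uniq c -> odd (size c) -> {in c, forall x, a (next c x) = - a x} ->
  {in c, forall x, a x = 0}.
Proof.
move=> Uc odd_c aN x xc.
have aE i : a (iter i (next c) x) = (-1) ^+ i * a x.
  elim: i => [|i IHi]; first by rewrite expr0 mul1r.
  by rewrite iterS aN ?iter_next_mem // IHi exprS mulN1r mulNr.
have := aE (size c); rewrite -(order_cycle (cycle_next Uc) Uc xc).
rewrite (iter_order_cycle (cycle_next Uc)) // (order_cycle (cycle_next Uc)) //.
by rewrite -signr_odd odd_c expr1 mulN1r; lra.
Qed.

Lemma incidence_vecE n (A : {set 'I_n}) j : incidence_vec A ord0 j = (j \in A)%:R.
Proof.
rewrite summxE (eq_bigr (fun i => (j == i)%:R)); last first.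
  by move=> i _; rewrite mxE eqxx.
case: (boolP (j \in A)) => jA.
  by rewrite (bigD1 j) //= eqxx big1 ?addr0 // => i /andP[_ /negPf]; rewrite eq_sym => ->.
by apply: big1 => i iA; case: eqP => // ji; rewrite ji iA in jA.
Qed.

Lemma unit_vecE n (i j : 'I_n) : unit_vec i ord0 j = (j == i)%:R.
Proof. by rewrite mxE eqxx. Qed.

Lemma comb_coord_cycle (R : realFieldType) n (c : seq 'I_n) (D : {set 'I_n})
    (a : 'I_n -> R) j :
  uniq c ->
  comb_coord [set x in c]
    (fun x => unit_vec x + unit_vec (next c x) + incidence_vec D) a j =
  (if j \in c then a j + a (prev c j) else 0) +
  (\sum_(x in c) a x) * (j \in D)%:R.
Proof.
move=> Uc; rewrite /comb_coord (eq_bigl (mem c)) => [|x]; last by rewrite inE.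
have pick (k : 'I_n) : \sum_(x in c) a x * (k == x)%:R = if k \in c then a k else 0.
  case: ifP => kc.
    rewrite (bigD1 k) //= eqxx mulr1 big1 ?addr0 // => x /andP[_ /negPf].
    by rewrite eq_sym => ->; rewrite mulr0.
  by apply: big1 => x xc; case: eqP => [kx|]; [rewrite kx xc in kc | rewrite mulr0].
rewrite mulr_suml -[if _ then _ else _]addr0.
have -> : (if j \in c then a j + a (prev c j) else 0) + 0 =
    \sum_(x in c) a x * (j == x)%:R + \sum_(x in c) a x * (prev c j == x)%:R.
  by rewrite !pick mem_prev; case: ifP; rewrite addr0.
rewrite -!big_split; apply: eq_bigr => x xc /=.
rewrite 2!mxE !unit_vecE incidence_vecE !rmorphD /= !mulrDr.
have -> : (j == next c x) = (prev c j == x).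
  by apply/eqP/eqP => [->|<-]; rewrite ?prev_next ?next_prev.
by case: (j == x); case: (prev c j == x); case: (j \in D).
Qed.

(** The rows are e_x + e_(next x) + e(D) for x on the cycle. Half of their sum
    has the half-integral coefficient (size c)/2 on D, which adding half of
    the - e_j for j in D rounds down. For a summand y with coefficients a, the
    coordinate y_(next x) = a_x + a_(next x) is an integer and both
    coefficients are at most 1/2, so they are both 0 or both 1/2; hence a is
    constant along the cycle. *)
Lemma hilbert_step_odd_cycle (R : realFieldType) n (S : 'rV[int]_n -> Prop)
    (c : seq 'I_n) (D : {set 'I_n}) :
  uniq c -> odd (size c) -> {in c, forall x, x \notin D} ->
  {in c, forall x, S (unit_vec x + unit_vec (next c x) + incidence_vec D)} ->
  (forall j, j \notin c -> S (- unit_vec j)) ->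
  hilbert_step R S (incidence_vec [set x in c] + incidence_vec D *+ (size c)./2).
Proof.
move=> Uc odd_c cD Sc SN.
pose f x := unit_vec x + unit_vec (next c x) + incidence_vec D.
have cycle_coord (a : 'I_n -> R) j : j \in c ->
    comb_coord [set x in c] f a j = a j + a (prev c j).
  by move=> jc; rewrite comb_coord_cycle // jc (negPf (cD j jc)) mulr0 addr0.
pose alpha j : R := 2^-1 * ((j \in c) || (j \in D))%:R.
have alphaE j : j \in c -> alpha j = 2^-1 by rewrite /alpha => ->; rewrite mulr1.
have [x0 x0c] : exists x0, x0 \in c.
  by case: (c) odd_c => // x0 c' _; exists x0; rewrite mem_head.
apply: (@hilbert_step_completion R n S [set x in c] f alpha).
- by move=> x; rewrite inE; exact: Sc.
- by move=> j; rewrite inE; exact: SN.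
- move=> a a0 x; rewrite inE; apply: odd_cycle_antiperiodic => // y yc.
  have := a0 (next c y); rewrite inE mem_next => /(_ yc).
  by rewrite cycle_coord ?mem_next // prev_next // => /eqP; rewrite addr_eq0 => /eqP.
- by move=> j; rewrite /alpha; case: (_ || _); rewrite ?mulr1 ?mulr0; lra.
- by move=> j _; rewrite /alpha; case: (_ || _); rewrite ?mulr1 ?mulr0; lra.
- move=> j; rewrite comb_coord_cycle // (eq_bigr (fun=> 2^-1)); last first.
    by move=> x xc; rewrite alphaE.
  rewrite mxE mulmxnE !incidence_vecE !inE rmorphD /= rmorphMn /=.
  have -> : \sum_(x in c) (2^-1 : R) = (size c)./2%:R + 2^-1.
    rewrite sumr_const (card_uniqP Uc) -{1}(odd_double_half (size c)) odd_c.
    by rewrite -[LHS]mulr_natl natrD -muln2 natrM /=; lra.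
  have [jc|jc] := boolP (j \in c).
    by rewrite (negPf (cD j jc)) !alphaE ?mem_prev //= mul0rn; lra.
  by rewrite /alpha (negPf jc) /=; case: (j \in D); rewrite /= ?mul0rn; lra.
- move=> a y le_a yE.
  have bound x : x \in c -> 0 <= a x /\ a x <= 2^-1.
    by move=> xc; apply/andP; have := le_a x; rewrite inE alphaE //; exact.
  have yE' x : x \in c -> a (next c x) + a x = (y (next c x))%:~R.
    move=> xc; have := yE (next c x); rewrite inE mem_next => /(_ xc) <-.
    by rewrite cycle_coord ?mem_next // prev_next.
  have y01 x : x \in c -> y (next c x) = 0 \/ y (next c x) = 1.
    move=> xc; have [a1 a2] := bound x xc.
    have [|a3 a4] := bound (next c x); first by rewrite mem_next.
    by apply: (@intr_01 R); rewrite -yE' //; lra.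
  have step x : x \in c -> (a x = 0 /\ a (next c x) = 0)
      \/ (a x = 2^-1 /\ a (next c x) = 2^-1).
    move=> xc; have [a1 a2] := bound x xc.
    have [|a3 a4] := bound (next c x); first by rewrite mem_next.
    by have := yE' x xc; case: (y01 x xc) => -> Ea; [left|right]; split; lra.
  case: (step x0 x0c) => -[ax0 _]; [left|right] => x; rewrite inE => xc.
    apply: (@next_closed_all _ c (fun z => a z = 0) Uc _ x0 x) => // z zc az.
    by case: (step z zc) => -[az1 ->] //; lra.
  rewrite alphaE //.
  apply: (@next_closed_all _ c (fun z => a z = 2^-1) Uc _ x0 x) => // z zc az.
  by case: (step z zc) => -[az1 ->] //; lra.
apply/eqP => /rowP/(_ x0); rewrite mxE mulmxnE !incidence_vecE inE x0c.
by rewrite (negPf (cD x0 x0c)) mul0rn addr0 mxE.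
Qed.

(** The sum of the e(A) - e_x over x in A is (#|A| - 1) e(A). For a summand y
    with coefficients a at most 1 / (#|A| - 1) and of sum s, the coordinate
    y_x = s - a_x is an integer strictly between -1 and 2, and two of
    these coordinates differ by at most 1 / (#|A| - 1) < 1, so y is constantly
    0 or constantly 1 on A. *)
Lemma hilbert_step_codim1 (R : realFieldType) n (S : 'rV[int]_n -> Prop)
    (A : {set 'I_n}) :
  (2 < #|A|)%N ->
  {in A, forall x, S (incidence_vec (A :\ x))} ->
  (forall j, j \notin A -> S (- unit_vec j)) ->
  hilbert_step R S (incidence_vec A).
Proof.
move=> A_gt2 SA SN; set N := #|A| in A_gt2.
pose f x := incidence_vec (A :\ x).
have coordE (a : 'I_n -> R) j : comb_coord A f a j =
    if j \in A then \sum_(i in A) a i - a j else 0.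
  rewrite /comb_coord; case: ifP => jA; last first.
    by apply: big1 => i _; rewrite incidence_vecE !inE jA andbF mulr0.
  rewrite (bigD1 j jA) [in RHS](bigD1 j jA) /= incidence_vecE !inE eqxx mulr0 add0r.
  rewrite addrAC subrr add0r; apply: eq_bigr => i /andP[_ ij].
  by rewrite incidence_vecE !inE eq_sym ij jA mulr1.
have N1_gt0 : (1 : R) < N.-1%:R by rewrite ltr1n; lia.
have NE : N%:R = N.-1%:R + 1 :> R by rewrite natr1 prednK //; lia.
pose al : R := N.-1%:R^-1.
have al_gt0 : 0 < al by rewrite invr_gt0; lra.
have al_lt1 : al < 1 by rewrite invf_lt1 //; lra.
have alE : N.-1%:R * al = 1 by rewrite mulfV //; lra.
have const_sum (a : 'I_n -> R) b : {in A, forall i, a i = b} ->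
    \sum_(i in A) a i = N.-1%:R * b + b.
  by move=> ab; rewrite (eq_bigr (fun=> b)) // sumr_const -[LHS]mulr_natl -/N NE mulrDl mul1r.
have [x0 x0A] : exists x0, x0 \in A by apply/card_gt0P; rewrite -/N; lia.
have eq0 (a : 'I_n -> R) : {in A, forall j, \sum_(i in A) a i - a j = 0} ->
    {in A, forall i, a i = 0}.
  move=> a0 j jA; set s := \sum_(i in A) a i in a0.
  have as_ : {in A, forall i, a i = s} by move=> i iA; have := a0 i iA; lra.
  have := const_sum a s as_; rewrite -/s => sE; rewrite as_ //.
  by apply/eqP; have /eqP : N.-1%:R * s = 0 by [lra]; rewrite mulf_eq0 => /orP[/eqP|//]; lra.
apply: (@hilbert_step_completion R n S A f (fun j => al * (j \in A)%:R)) => //.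
- by move=> a a0; apply: eq0 => j jA; have := a0 j jA; rewrite coordE jA.
- by move=> i; rewrite mulr_ge0 // ltW.
- by move=> i /negPf->; rewrite mulr0.
- move=> j; rewrite coordE incidence_vecE; case: ifP => jA; last first.
    by rewrite mulr0 subr0.
  rewrite (const_sum _ al) => [|i ->]; last by rewrite mulr1.
  by rewrite alE jA mulr1 /=; lra.
- move=> a y le_a yE; set s := \sum_(i in A) a i.
  have yE' i : i \in A -> s - a i = (y i)%:~R.
    by move=> iA; have := yE i iA; rewrite coordE iA.
  have bound i : i \in A -> 0 <= a i /\ a i <= al.
    by move=> iA; apply/andP; have := le_a i iA; rewrite iA mulr1.
  have s_ge0 : 0 <= s by apply: sumr_ge0 => i /bound[].
  have s_le : s <= 1 + al.
    have -> : 1 + al = \sum_(i in A) al by rewrite (const_sum _ al) // alE.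
    by apply: ler_sum => i /bound[].
  have y01 i : i \in A -> y i = 0 \/ y i = 1.
    by move=> iA; have [a1 a2] := bound i iA; apply: (@intr_01 R); rewrite -yE' //; lra.
  have yconst i : i \in A -> y i = y x0.
    move=> iA; have [a1 a2] := bound i iA; have [a3 a4] := bound x0 x0A.
    have := yE' i iA; have := yE' x0 x0A.
    by case: (y01 i iA) => ->; case: (y01 x0 x0A) => -> // ? ?; exfalso; lra.
  have sE i : i \in A -> s - a i = (y x0)%:~R by move=> iA; rewrite yE' // yconst.
  case: (y01 x0 x0A) => y0; rewrite y0 in sE; first by left; apply: eq0.
  right=> i iA; have : {in A, forall i, a i - al = 0}; last first.
    by rewrite iA mulr1 => /(_ i iA); lra.
  apply: (eq0 (fun i => a i - al)) => j jA.
  rewrite sumrB -/s (const_sum _ al) // alE; have := sE j jA; lra.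
apply/eqP => /rowP/(_ x0); rewrite incidence_vecE x0A mxE; exact/eqP/oner_neq0.
Qed.

(** * Graphs *)

Lemma next_nth_mod (T : eqType) (x0 : T) (c : seq T) i :
  uniq c -> (i < size c)%N ->
  next c (nth x0 c i) = nth x0 c (i.+1 %% size c)%N.
Proof.
case: c => // y p Uc lt_i; rewrite next_nth mem_nth // index_uniq //.
have [lt_ip|le_pi] := ltnP i (size p).
  by rewrite modn_small //= (set_nth_default x0).
have -> : i = size p by apply/eqP; rewrite eqn_leq le_pi -ltnS lt_i.
by rewrite nth_default // modnn.
Qed.

(** The doubling map i |-> 2 i mod N, a permutation since N is odd, lists the
    even positions and then the odd ones. Consecutive positions differ by 2,
    except for the jumps from N - 1 to 1 and from N - 2 back to 0, which are
    longer; and the pair of ends {0, N - 1} is never used. So one hypothesis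
    suits both the complement of a path and the complement of a cycle. *)
Lemma doubling_cycle (T : eqType) (e : rel T) (x0 : T) (p : seq T) :
  symmetric e -> odd (size p) -> (4 < size p)%N -> uniq p ->
  (forall i j, (i.+1 < j)%N -> (j < size p)%N -> (0 < i)%N || (j.+1 < size p)%N ->
     e (nth x0 p i) (nth x0 p j)) ->
  exists2 q, ucycle e q & perm_eq q p.
Proof.
move=> e_sym odd_p p_gt4 Up ep; set N := size p in odd_p p_gt4 ep *.
pose g i := nth x0 p (i.*2 %% N)%N.
have dblE i : (i < N)%N -> (i.*2 %% N = if i.*2 < N then i.*2 else i.*2 - N)%N.
  move=> lt_iN; case: ltnP => [/modn_small//|le_N].
  by rewrite -{1}(subnK le_N) modnDr modn_small //; lia.
have perm_dbl : perm_eq [seq (i.*2 %% N)%N | i <- iota 0 N] (iota 0 N).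
  have U : uniq [seq (i.*2 %% N)%N | i <- iota 0 N].
    rewrite map_inj_in_uniq ?iota_uniq // => i j; rewrite !mem_iota !add0n.
    move=> /andP[_ iN] /andP[_ jN]; rewrite !dblE //.
    have NE : N = (N./2.*2).+1 by rewrite -[LHS]odd_double_half odd_p.
    by case: (ltnP i.*2 N); case: (ltnP j.*2 N); lia.
  apply: uniq_perm; rewrite ?iota_uniq //.
  apply: (uniq_min_size U _ _).2; last by rewrite size_map.
  by move=> _ /mapP[i _ ->]; rewrite mem_iota add0n /= ltn_mod; lia.
have eg i : e (g i) (g i.+1).
  rewrite /g doubleS -addn2 -modnDml.
  have := ltn_pmod i.*2 (ltn_trans (ltn0Sn 3) p_gt4); set a := (_ %% N)%N => lt_aN.
  have [lt_a2|le_a2] := ltnP (a + 2) N.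
    by rewrite modn_small //; apply: ep; lia.
  have -> : ((a + 2) %% N = a + 2 - N)%N.
    by rewrite -{1}(subnK le_a2) modnDr modn_small //; lia.
  by rewrite e_sym; apply: ep; lia.
exists [seq g i | i <- iota 0 N]; last first.
  rewrite (map_comp (nth x0 p)) -[X in perm_eq _ X](mkseq_nth x0); exact: perm_map.
rewrite /ucycle; apply/andP; split; last first.
  rewrite (perm_uniq (_ : perm_eq _ p)) //.
  rewrite (map_comp (nth x0 p)) -[X in perm_eq _ X](mkseq_nth x0); exact: perm_map.
have path_g m k : path e (g m) [seq g i | i <- iota m.+1 k].
  by elim: k m => //= k IHk m; rewrite eg IHk.
have gN : g N = g 0%N by rewrite /g -muln2 modnMr mod0n.
have [M NE] : exists M, N = M.+1 by exists N.-1; lia.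
rewrite NE /= -cats1 -[X in _ ++ [:: X]]gN NE.
by have := path_g 0%N M.+1; rewrite -(addn1 M) iotaD map_cat add1n addn1.
Qed.

Lemma antihole_edge (T : finType) (e : rel T) (A : {set T}) (c : seq T) (x0 : T) i j :
  A =i c -> uniq c -> chordless (complement_on (induced e A) A) c ->
  (i.+1 < j)%N -> (j < size c)%N -> (0 < i)%N || (j.+1 < size c)%N ->
  e (nth x0 c i) (nth x0 c j).
Proof.
move=> Ac Uc chordless_c lt_ij lt_jc not_wrap; apply: contraT => not_e.
have lt_i1c := ltn_trans lt_ij lt_jc; have lt_ic := ltnW lt_i1c.
have c_gt0 := leq_ltn_trans (leq0n i) lt_ic.
have [ic jc] : nth x0 c i \in c /\ nth x0 c j \in c by rewrite !mem_nth.
have neq_ij : i != j by lia.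
have /orP[] : (nth x0 c j == next c (nth x0 c i)) || (nth x0 c i == next c (nth x0 c j)).
- apply: chordless_c => //; rewrite /complement_on /induced /= !Ac ic jc.
  by rewrite nth_uniq // neq_ij (negPf not_e).
- by rewrite next_nth_mod // nth_uniq ?ltn_mod // modn_small // => /eqP; lia.
rewrite next_nth_mod // nth_uniq ?ltn_mod //.
have [lt_j1|le_j1] := ltnP j.+1 (size c).
  by rewrite modn_small // => /eqP; lia.
by have -> : j.+1 = size c by [lia]; rewrite modnn => /eqP; lia.
Qed.

Lemma step1_neg_unit (R : realFieldType) n (e : rel 'I_n) j :
  iterated_system e R 1 (- unit_vec j).
Proof.
apply: (@hilbert_step_mem R n _ _ j); last by move=> i; right; exists i.
  by right; exists j.
by rewrite mxE unit_vecE eqxx normrN1.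
Qed.

Lemma step1_odd_cycle (R : realFieldType) n (e : rel 'I_n) (c : seq 'I_n) :
  ucycle e c -> odd (size c) -> iterated_system e R 1 (incidence_vec [set x in c]).
Proof.
move=> /andP[cyc_c Uc] odd_c; have inc0 : incidence_vec (set0 : {set 'I_n}) = 0.
  exact: big_set0.
(* An odd cycle is the case where D is empty. *)
rewrite -[incidence_vec _]addr0 -(mul0rn _ (size c)./2) -inc0.
apply: hilbert_step_odd_cycle => //.
- by move=> x _; rewrite inE.
- move=> x xc; left; exists x, (next c x); rewrite inc0 addr0; split=> //.
  exact: next_cycle.
- by move=> j _; right; exists j.
Qed.

Lemma step2_odd_cycle (R : realFieldType) n (e : rel 'I_n) (c : seq 'I_n) :
  ucycle e c -> odd (size c) -> iterated_system e R 2 (incidence_vec [set x in c]).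
Proof.
move=> cyc_c odd_c; have [x xc] : exists x, x \in c.
  by case: (c) odd_c => // x c' _; exists x; rewrite mem_head.
apply: (@hilbert_step_mem R n _ _ x); first exact: step1_odd_cycle.
  by rewrite incidence_vecE inE xc.
exact: step1_neg_unit.
Qed.

(** Rotating the hole so that x comes first turns the remaining vertices into
    the path to which the doubling map applies in the even case. *)
Lemma antihole_vec_step2 (R : realFieldType) n (e : rel 'I_n) (A : {set 'I_n}) :
  symmetric e -> antihole e A -> (4 < #|A|)%N ->
  iterated_system e R 2 (incidence_vec A).
Proof.
move=> e_sym [c [Ac [[_ /andP[_ Uc]] chordless_c]]].
have card_A : #|A| = size c by rewrite (eq_card Ac); apply/card_uniqP.
rewrite card_A => c_gt4.
have setE (q : seq 'I_n) (B : {set 'I_n}) : B =i q -> [set x in q] = B.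
  by move=> Bq; apply/setP => x; rewrite inE Bq.
have [odd_c|even_c] := boolP (odd (size c)).
  have [x0 _] : exists x0, x0 \in c by case: (c) c_gt4 => // x *; exists x; rewrite mem_head.
  have [|q cyc_q perm_q] := @doubling_cycle _ e x0 c e_sym odd_c c_gt4 Uc.
    by move=> i j; exact: antihole_edge.
  rewrite -(setE q A) => [|x]; last by rewrite Ac (perm_mem perm_q).
  by apply: step2_odd_cycle => //; rewrite (perm_size perm_q).
apply: hilbert_step_codim1; first by rewrite card_A; lia.
  move=> x; rewrite Ac => /rot_to[i p def_p].
  have Up : uniq (x :: p) by rewrite -def_p rot_uniq.
  have size_p : size c = (size p).+1 by rewrite -(size_rot i) def_p.
  have Axp : A =i x :: p by move=> y; rewrite Ac -def_p mem_rot.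
  have chordless_p : chordless (complement_on (induced e A) A) (x :: p).
    move=> y z; rewrite -def_p !mem_rot !next_rot //; exact: chordless_c.
  have odd_p : odd (size p) by move: even_c; rewrite size_p /= negbK.
  have p_gt4 : (4 < size p)%N.
    by move: c_gt4 odd_p; rewrite size_p; case: (size p) => [|[|[|[|[]]]]].
  case/andP: (Up) => xp Up'.
  have [|q cyc_q perm_q] := @doubling_cycle _ e x p e_sym odd_p p_gt4 Up'.
    move=> j k lt_jk lt_kp _.
    exact: (@antihole_edge _ e A (x :: p) x j.+1 k.+1).
  rewrite -(setE q (A :\ x)).
    by apply: step1_odd_cycle => //; rewrite (perm_size perm_q).
  move=> y; rewrite (perm_mem perm_q) !inE Axp inE.
  by case: eqP => //= ->; rewrite (negPf xp).
by move=> j _; exact: step1_neg_unit.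
Qed.

Lemma wheel_vec_step2 (R : realFieldType) n (e : rel 'I_n) (W : {set 'I_n}) u :
  symmetric e -> irreflexive e -> odd_wheel e W u ->
  iterated_system e R 2 (wheel_vec W u).
Proof.
move=> e_sym e_irr [[c [[_ /andP[cyc_c Uc]] uc eu Wc]] odd_W].
have rimE : W :\ u = [set x in c].
  apply/setP => x; rewrite !inE Wc inE; case: eqP => // ->.
  by rewrite (negPf uc).
have size_c : #|W :\ u| = size c by rewrite rimE cardsE; apply/card_uniqP.
have card_W : #|W| = (size c).+1 by rewrite (cardsD1 u) Wc mem_head size_c.
rewrite size_c in odd_W.
have -> : wheel_vec W u =
    incidence_vec [set x in c] + incidence_vec [set u] *+ (size c)./2.
  rewrite /wheel_vec rimE card_W /incidence_vec big_set1; congr (_ + _ *+ _); lia.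
apply: hilbert_step_odd_cycle => //.
- by move=> x xc; rewrite inE; apply: contraNneq uc => <-.
- move=> x xc; set y := next c x.
  have exy : e x y by exact: next_cycle.
  have neq_xy : x != y by apply: contraTneq exy => <-; rewrite e_irr.
  have yc : y \in c by rewrite mem_next.
  have [xu yu] : x != u /\ y != u.
    by split; apply: contraNneq uc => <-.
  have -> : unit_vec x + unit_vec y + incidence_vec [set u] =
      incidence_vec [set z in [:: x; y; u]].
    apply/rowP => z; rewrite 2!mxE !unit_vecE !incidence_vecE !inE.
    by case: (eqVneq z x) => [->|_]; [rewrite (negPf neq_xy) (negPf xu)|
       case: (eqVneq z y) => [->|_]; rewrite ?(negPf yu) ?add0r].
  apply: step1_odd_cycle => //.
  by rewrite /ucycle /= exy (e_sym y) !eu //= !inE negb_or neq_xy xu yu.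
by move=> j _; exact: step1_neg_unit.
Qed.

Theorem corollary4p15 (R : realFieldType) (n : nat) (e : rel 'I_n)
    (e_sym : symmetric e) (e_irr : irreflexive e) :
  (forall A : {set 'I_n}, antihole e A -> (4 < #|A|)%N ->
     iterated_system e R 2 (incidence_vec A)) /\
  (forall (W : {set 'I_n}) (u : 'I_n), odd_wheel e W u ->
     iterated_system e R 2 (wheel_vec W u)).
Proof.
split=> [A|W u]; first exact: antihole_vec_step2.
exact: wheel_vec_step2.
Qed.
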